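(* For $A\subseteq\mathbb N$, the following statements are equivalent: (1) there exist an infinite set $B\subseteq\mathbb N$ and $t\in\mathbb Z_+$ such that $B^{\oplus2}\subseteq A-t$; (2) there exist $e\in\mathcal A(X_A,T)$ and $t\in\mathbb Z_+$ such that $e^2a\in T^{-t}E_A$; (3) there exist a nonprincipal ultrafilter $\mathfrak u\in\beta\mathbb N\setminus\mathbb N$ and $t\in\mathbb Z_+$ such that $A-t\in\mathfrak u+\mathfrak u$; (4) there exist $\mathfrak u\in\beta\mathbb N\setminus\mathbb N$ and $t\in\mathbb Z_+$ such that, on setting $\mathfrak p=\mathfrak u$ and $\mathfrak q=\mathfrak u+t$, the ultrafilters $\mathfrak p$ and $\mathfrak q$ are nonprincipal and satisfy $\mathfrak p+\mathfrak q=\mathfrak q+\mathfrak p$ and $A\in\mathfrak p+\mathfrak q$; (5) there exist nonprincipal ultrafilters $\mathfrak p,\mathfrak q\in\beta\mathbb N$ such that $\mathfrak p+\mathfrak q=\mathfrak q+\mathfrak p$ and $A\in\mathfrak p+\mathfrak q$.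
   Context: $\mathbb N=\{1,2,\ldots\}$, $\mathbb Z_+=\{0,1,2,\ldots\}$. For $C\subseteq\mathbb N$ and $t\in\mathbb Z_+$, $C-t:=\{n\in\mathbb N:n+t\in C\}$. $B^{\oplus 2}:=\{\sum_{n\in F}n:F\subseteq B,\ |F|=2\}$. Symbolic system of $A$: let $\Sigma=\{0,1\}^{\mathbb Z}$ with shift $(Tz)_j=z_{j+1}$, let $a\in\Sigma$ be the indicator of $A$ (with $a_j=0$ for $j\le0$), $X_A=\overline{\{T^na:n\in\mathbb Z\}}$ and $E_A=\{z\in X_A:z_0=1\}$; $T$ also denotes the restriction of the shift to $X_A$. For a compact metric space $X$ and homeomorphism $T$ of $X$, the adherence semigroup is $\mathcal A(X,T)=\bigcap_{m=1}^{\infty}\overline{\{T^n:n\ge m\}}$, with closures in $X^X$ under the topology of pointwise convergence; elements are multiplied by composition. $\beta\mathbb N$ is the set of ultrafilters on $\mathbb N$, with $\mathbb N$ identified with the principal ultrafilters. Addition is defined by $C\in\mathfrak r+\mathfrak s\iff\{n\in\mathbb N:C-n\in\mathfrak s\}\in\mathfrak r$. For $t\ge1$, $\mathfrak u+t$ is the sum with the principal ultrafilter at $t$ (so $C\in\mathfrak u+t\iff C-t\in\mathfrak u$); $\mathfrak u+0:=\mathfrak u$. *)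

(* Defs.v *)
From mathcomp Require Import all_boot all_order all_algebra finmap.
From mathcomp Require Import all_classical topology.

Set Implicit Arguments.
Unset Strict Implicit.
Unset Printing Implicit Defensive.

Import Order.TTheory GRing.Theory Num.Theory.
Local Open Scope classical_set_scope.

(* The natural numbers 1, 2, ...; nat itself plays the role of Z_+. *)
Notation natp := {n : nat | (0 < n)%N}.

Lemma natp_add_subproof (n : natp) (t : nat) : (0 < val n + t)%N.
Proof. by rewrite addn_gt0 (valP n). Qed.

Definition natp_add (n : natp) (t : nat) : natp :=
  exist _ (val n + t)%N (natp_add_subproof n t).

Definition translate (C : set natp) (t : nat) : set natp :=
  [set n | C (natp_add n t)].

Definition pair_sums (B : set natp) : set natp :=
  [set m | exists F : {fset natp},
     [/\ [set` F] `<=` B, #|` F|%fset = 2 & val m = (\sum_(n <- F) val n)%N]].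

(* prod_topology of discrete copies of bool *)
Notation Sigma := {ptws int -> bool}.

Definition shift (z : Sigma) : Sigma := fun j : int => z (j + 1)%R.
Definition shift_inv (z : Sigma) : Sigma := fun j : int => z (j - 1)%R.

Lemma shiftK : cancel shift shift_inv.
Proof. by move=> z; apply/funext => j; rewrite /shift_inv /shift subrK. Qed.

Lemma shift_invK : cancel shift_inv shift.
Proof. by move=> z; apply/funext => j; rewrite /shift_inv /shift addrK. Qed.

Definition shiftz (n : int) : Sigma -> Sigma :=
  match n with Posz k => iter k shift | Negz k => iter k.+1 shift_inv end.

Lemma shiftzE n z j : shiftz n z j = z (j + n)%R.
Proof.
case: n => k; elim: k j => [|k IHk] j.
- by rewrite addr0.
- by rewrite [LHS]IHk -addrA -PoszD add1n.
- by [].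
- by rewrite [LHS]IHk !NegzE -addrA -opprD -PoszD add1n.
Qed.

Lemma shift_continuous : continuous shift.
Proof.
move=> z; apply/(cvg_sup _ _) => j.
apply/cvg_image; first by rewrite eqEsubset; split => b // _; exists (fun=> b).
move=> W /(@proj_continuous int (fun=> bool) (j + 1)%R z) zW.
exists ((fun y : Sigma => y j) @^-1` W) => //.
by rewrite image_preimage // eqEsubset; split => b // _; exists (fun=> b).
Qed.

(* natp is positive, so the indicator vanishes on nonpositive integers. *)
Definition indicator (A : set natp) : Sigma :=
  fun j : int => `[< exists2 n : natp, A n & j = Posz (val n) >].

Definition orbit_closure (A : set natp) : set Sigma :=
  closure [set shiftz n (indicator A) | n in [set: int]].

Lemma orbit_closure_base A : orbit_closure A (indicator A).
Proof. by apply: subset_closure; exists 0%R. Qed.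

Lemma orbit_closure_shift A z : orbit_closure A z -> orbit_closure A (shift z).
Proof.
move=> Xz W /shift_continuous /Xz [_ [[n _ <-] Ws]].
exists (shift (shiftz n (indicator A))); split=> //.
exists (n + 1)%R => //; apply/funext => j.
by rewrite /shift !shiftzE -addrA (addrC n).
Qed.

(* X_A with the initial topology of its inclusion into Sigma *)
Definition system (A : set natp) : topologicalType := set_type (orbit_closure A).

Definition system_base (A : set natp) : system A :=
  exist _ (indicator A) (mem_set (orbit_closure_base (A := A))).

Definition system_shift (A : set natp) (z : system A) : system A :=
  exist _ (shift (val z)) (mem_set (orbit_closure_shift (set_mem (valP z)))).

Definition system_cylinder (A : set natp) : set (system A) :=
  [set z | (val z : Sigma) 0%R = true].

(* Applied below only to homeomorphisms of compact metrizable spaces; members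
   need not be continuous. *)
Definition adherence (X : topologicalType) (T : X -> X) : set {ptws X -> X} :=
  \bigcap_(m in [set m : nat | (1 <= m)%N])
    closure [set (iter n T : {ptws X -> X}) | n in [set n : nat | (m <= n)%N]].

Record betaN := BetaN {
  ultra_sets : set_system natp;
  ultra_setsP : UltraFilter ultra_sets }.

Lemma betaN_ext (u v : betaN) : ultra_sets u = ultra_sets v -> u = v.
Proof.
case: u v => [U uU] [V uV] /= UV; rewrite UV in uU *.
by congr BetaN; exact: Prop_irrelevance.
Qed.

Definition principal (n : natp) : betaN :=
  BetaN (principal_filter_ultra n).

Definition nonprincipal (u : betaN) : Prop := forall n, u <> principal n.

Lemma ultra_add_subproof (r s : betaN) :
  UltraFilter
    [set C | ultra_sets r [set n : natp | ultra_sets s (translate C (val n))]].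
Proof.
case: r s => [R uR] [S uS] /=.
have pR : ProperFilter R by exact: ultra_proper.
have pS : ProperFilter S by exact: ultra_proper.
split.
  split=> [/= H|].
    apply: (@filter_not_empty _ R); apply: filterS H => n /=.
    exact: filter_not_empty.
  split.
  - by rewrite /=; apply: filterE => n /=; exact: filterE.
  - by move=> C D /= RC RD; apply: filterS2 RC RD => n SC SD; exact: filterI.
  - by move=> C D CD /=; apply: filterS => n /=; apply: filterS => m; exact: CD.
move=> G GG sG; apply/seteqP; split=> // C GC /=.
have [//|RnC] := in_ultra_setVsetC [set n : natp | S (translate C (val n))] uR.
exfalso; apply: (@filter_not_empty _ G); rewrite -(setICr C).
apply: filterI => //; apply: sG => /=; apply: filterS RnC => n /= nSC.
by have [] := in_ultra_setVsetC (translate C (val n)) uS.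
Qed.

Definition ultra_add (r s : betaN) : betaN := BetaN (ultra_add_subproof r s).

Definition ultra_addn (u : betaN) (t : nat) : betaN :=
  match t with
  | 0 => u
  | k.+1 => ultra_add u (principal (exist _ k.+1 (ltn0Sn k)))
  end.

Lemma ultra_addnE (u : betaN) (t : nat) (C : set natp) :
  ultra_sets (ultra_addn u t) C <-> ultra_sets u (translate C t).
Proof.
case: t => [|k] /=.
  suff -> : translate C 0 = C by [].
  apply/funext => n; rewrite /translate /=; congr C.
  by apply/val_inj; rewrite /= addn0.
suff -> : [set n : natp | principal_filter (exist _ k.+1 (ltn0Sn k) : natp)
   (translate C (val n))] = translate C k.+1 by [].
apply/funext => n; apply/propext; rewrite /= principal_filterP /translate /=.
suff -> : natp_add (exist _ k.+1 (ltn0Sn k)) (val n) = natp_add n k.+1 by [].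
by apply/val_inj; rewrite /= addnC.
Qed.

(* Main.v *)
(* A point e of the adherence semigroup is the limit of T^n along some
   nonprincipal u, and (e e a)_t = u-lim_n u-lim_m a_(t+n+m), which is 1 exactly
   when A - t is in u + u; picking the elements of B one after the other in
   sets of u gives the pair sums.  Given p + q = q + p, some n + q is a limit
   of the points m + p with m >= n (or vice versa); applied to the set of the
   n + k with A - k in p, which is in n + q since A is in q + p, this yields m
   with A - (m - n) in p + p. *)

Require Import Defs.
From mathcomp Require Import all_boot all_order all_algebra finmap.
From mathcomp Require Import all_classical topology.

Local Open Scope classical_set_scope.

Implicit Types (u p q : betaN) (A C : set natp).

(** * Ultrafilters on the positive integers *)

#[local] Instance ultra_sets_ultra u : UltraFilter (ultra_sets u).
Proof. exact: ultra_setsP. Qed.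

Lemma ultra_setsC u C : ultra_sets u (~` C) <-> ~ ultra_sets u C.
Proof.
split=> [uCc uC|]; last by case: (in_ultra_setVsetC C (ultra_setsP u)).
by apply: (@filter_not_empty _ (ultra_sets u)); rewrite -(setICr C);
  exact: filterI.
Qed.

Lemma principalP u n : u = principal n <-> ultra_sets u [set n].
Proof.
split=> [->|un]; first exact/principal_filterP.
apply: betaN_ext; apply: max_filter => C /principal_filterP Cn.
by apply: filterS un => _ ->.
Qed.

Lemma nonprincipalP u :
  nonprincipal u <-> forall N : nat, ultra_sets u [set n | (N < val n)%N].
Proof.
split=> [u_np|u_gt n /principalP un]; last first.
  by have [m [-> /=]] := filter_ex (filterI un (u_gt (val n))); rewrite ltnn.
elim=> [|N IHN]; first by apply: filterE => n; exact: valP n.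
have uN : ultra_sets u (~` [set n : natp | val n = N.+1]).
  apply/ultra_setsC => uN; apply: (u_np (exist _ N.+1 (ltn0Sn N))).
  by apply/principalP; apply: filterS uN => n nN; exact: val_inj.
apply: filterS2 IHN uN => n; rewrite /= leq_eqVlt => /orP[/eqP <- //|//].
Qed.

(** * Commuting sums of ultrafilters *)

Lemma filter_bounded_forall (T : Type) (F : set_system T) (FF : Filter F)
    (C : nat -> set T) N :
  (forall i, (i <= N)%N -> F (C i)) ->
  F [set x | forall i, (i <= N)%N -> C i x].
Proof.
elim: N => [|N IHN] FC.
  by apply: filterS (FC 0 (leqnn 0)) => x Cx i; rewrite leqn0 => /eqP ->.
have FN := IHN (fun i iN => FC i (leqW iN)).
apply: filterS2 FN (FC N.+1 (leqnn _)) => x CN CSN i.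
by rewrite leq_eqVlt => /orP[/eqP -> //|]; exact: CN.
Qed.

(* The sequences n + q and n + p accumulate at the same point p + q = q + p of
   beta N, which is an F-space: if each n + q avoided the closure of
   {m + p | m >= n} and vice versa, the separating sets could be made disjoint.
   Here X is in n + q iff q contains translate X n. *)
Lemma commuting_ultra_meet p q : ultra_add p q = ultra_add q p ->
  (exists n : nat, forall C, ultra_sets q (translate C n) ->
     exists2 m, (n <= m)%N & ultra_sets p (translate C m)) \/
  (exists n : nat, forall C, ultra_sets p (translate C n) ->
     exists2 m, (n <= m)%N & ultra_sets q (translate C m)).
Proof.
move=> pqE; apply: contrapT => /not_orP[/forallNP sepq /forallNP sepp].
have separate (r s : betaN) :
    (forall n : nat, ~ forall C, ultra_sets r (translate C n) ->
       exists2 m, (n <= m)%N & ultra_sets s (translate C m)) ->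
    exists X : nat -> set natp, forall n, ultra_sets r (translate (X n) n) /\
      forall m, (n <= m)%N -> ~ ultra_sets s (translate (X n) m).
  move=> sep; suff: forall n, exists C, ultra_sets r (translate C n) /\
    forall m, (n <= m)%N -> ~ ultra_sets s (translate C m)
    by move=> /boolp.choice[X XP]; exists X.
  move=> n; have /existsNP[C /not_implyP[rC sC]] := sep n.
  by exists C; split=> // m nm sCm; apply: sC; exists m.
have [X XP] := separate _ _ sepq; have [Y YP] := separate _ _ sepp.
(* Standard disjointification of two countable families: [disj X Y] and [disj Y X] cannot meet,
   because of two witnessing indices the smaller is excluded by the larger. *)
pose disj (V W : nat -> set natp) : set natp :=
  [set k | exists2 n, V n k & forall i, (i <= n)%N -> ~ W i k].
have ultra_disj (r s : betaN) (V W : nat -> set natp) :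
    (forall n, ultra_sets s (translate (V n) n)) ->
    (forall i n, (i <= n)%N -> ~ ultra_sets s (translate (W i) n)) ->
    ultra_sets (ultra_add r s) (disj V W).
  move=> sV sW; rewrite /=; apply: filterE => n /=.
  have sWn : ultra_sets s [set k | forall i, (i <= val n)%N ->
      (~` translate (W i) (val n)) k].
    by apply: filter_bounded_forall => i iN; apply/ultra_setsC; exact: sW.
  by apply: filterS2 (sV (val n)) sWn => k Vk Wk; exists (val n).
(* For each outer variable [n], [q] contains [X n - n] and misses [Y i - n] for the finitely many
   [i <= n]. The next sum is symmetric. *)
have pqX : ultra_sets (ultra_add p q) (disj X Y).
  by apply: ultra_disj => [n|i n]; [case: (XP n) | case: (YP i) => _; apply].
have qpY : ultra_sets (ultra_add q p) (disj Y X).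
  by apply: ultra_disj => [n|i n]; [case: (YP n) | case: (XP i) => _; apply].
rewrite -pqE in qpY.
have [k [[n Xnk nYk] [m Ymk nXk]]] := filter_ex (filterI pqX qpY).
by have [/nYk|/ltnW/nXk] := leqP m n; apply.
Qed.

Lemma translateD C s t : translate (translate C s) t = translate C (t + s)%N.
Proof.
apply/funext => n; rewrite /translate /=; congr C.
by apply: val_inj; rewrite /= addnA.
Qed.

(** This moves a translation across a sum: [C - s] is in [r + p] exactly when the translate by [s]
    of the set of [k] with [C - k] in [p] lies in [r]. *)
Lemma translate_ultra_set p C s :
  translate [set k | ultra_sets p (translate C (val k))] s =
  [set k | ultra_sets p (translate (translate C s) (val k))].
Proof. by apply/funext => k; rewrite /= translateD. Qed.

Lemma commuting_ultra_double p q A : ultra_add p q = ultra_add q p ->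
  ultra_sets (ultra_add p q) A ->
  exists u t, (u = p \/ u = q) /\
    ultra_sets (ultra_add u u) (translate A t).
Proof.
have half (r s : betaN) (n : nat) : (forall C, ultra_sets s (translate C n) ->
       exists2 m, (n <= m)%N & ultra_sets r (translate C m)) ->
     ultra_sets (ultra_add s r) A ->
     exists t, ultra_sets (ultra_add r r) (translate A t).
  move=> meet srA.
  pose D := [set k : natp | ultra_sets r (translate A (val k))].
  (* The test set is [D + n], whose translate by [n] contains [D], a member of [s]. Since [m >= n],
     its translate by [m] is contained in [D - (m - n)]. *)
  have [|m nm rm] := meet [set k | exists2 j, D j & natp_add j n = k].
    by apply: filterS (srA : ultra_sets s D) => k Dk; exists k.
  exists (m - n)%N; rewrite /= -translate_ultra_set.
  apply: filterS rm => k [j Dj /(congr1 val)/= jk].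
  rewrite -[_ k]/(D (natp_add k (m - n))).
  suff -> : natp_add k (m - n) = j by [].
  by apply: val_inj; rewrite /= addnBA// -jk addnK.
move=> pqE pqA; have [[n meet]|[n meet]] := commuting_ultra_meet _ _ pqE.
- have [|t ?] := half _ _ _ meet; first by rewrite -pqE.
  by exists p, t; split; [left|].
- by have [//|t ?] := half _ _ _ meet; exists q, t; split; [right|].
Qed.

(** Principal ultrafilters are central: both sums contain [C] exactly when [u + u] contains
    [C - t]. *)
Lemma ultra_addnC u t :
  ultra_add u (ultra_addn u t) = ultra_add (ultra_addn u t) u.
Proof.
apply: betaN_ext; apply/funext => C; apply/propext.
rewrite [X in _ <-> X]ultra_addnE translate_ultra_set /=.
suff -> : [set n : natp | ultra_sets (ultra_addn u t) (translate C (val n))] =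
  [set n : natp | ultra_sets u (translate (translate C t) (val n))] by [].
apply/funext => n; apply/propext.
by rewrite /= ultra_addnE !translateD addnC.
Qed.

Lemma nonprincipal_addn u t : nonprincipal u -> nonprincipal (ultra_addn u t).
Proof.
move=> /nonprincipalP u_gt; apply/nonprincipalP => N; apply/ultra_addnE.
by apply: filterS (u_gt N) => n; exact: ltn_addr.
Qed.

(** * Pair sums and the ultrafilters [u + u] *)

Lemma infinite_set_natp (B : set natp) :
  infinite_set B <-> forall N : nat, exists2 b, B b & (N < val b)%N.
Proof.
split=> [Binf N|B_gt Bfin].
  apply: contrapT => B_le; apply: Binf.
  apply: (@sub_finite_set _ _ (val @^-1` `I_N.+1)) => [b Bb|].
    rewrite /= ltnS leqNgt; apply/negP => Nb; apply: B_le; by exists b.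
  by apply: finite_preimage => // x y _ _; exact: val_inj.
suff [N BN] : exists N, forall b, B b -> (val b <= N)%N.
  by have [b /BN] := B_gt N; rewrite leqNgt => /negPf ->.
have /finite_seqP[s ->] := Bfin.
exists (\max_(b <- s) val b)%N => b /= bs.
by rewrite (big_rem b)//= leq_maxl.
Qed.

Lemma pair_sumsP (B : set natp) (m : natp) : pair_sums B m <->
  exists x y : natp,
    [/\ B x, B y, (val x < val y)%N & val m = (val x + val y)%N].
Proof.
split=> [[F [FB cF ->]]|[x [y [Bx By xy mE]]]]; last first.
  exists [fset x; y]%fset; split.
  - by move=> z /=; rewrite !inE => /orP[] /eqP ->.
  - by rewrite cardfs2 -(inj_eq val_inj) (ltn_eqF xy).
  - rewrite mE big_fsetU1 ?big_seq_fset1 // inE.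
    by rewrite -(inj_eq val_inj) (ltn_eqF xy).
have FB' z : z \in enum_fset F -> B z by move=> zF; exact: FB.
have := fset_uniq F; move: cF FB'; rewrite /=.
case: (enum_fset F) => [|x [|y []]]//= _ FB'; rewrite inE andbT => xy.
rewrite !big_cons big_nil addn0.
have Bx : B x by apply: FB'; rewrite mem_head.
have By : B y by apply: FB'; rewrite !inE eqxx orbT.
case: (ltngtP (val x) (val y)) => [ltxy|ltyx|/val_inj/eqP]; last 1 first.
- by move: xy; rewrite -(inj_eq val_inj) => /negPf ->.
- by exists x, y.
- by exists y, x; split=> //; rewrite addnC.
Qed.

Lemma nonprincipal_extension (F : set_system natp) : Filter F ->
  (forall C N, F C -> exists2 n, C n & (N < val n)%N) ->
  exists2 u, nonprincipal u & F `<=` ultra_sets u.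
Proof.
move=> FF F_gt.
(* [G] is the filter generated by [F] and all tails. It is proper because members of [F] are
   unbounded, and every ultrafilter above it is nonprincipal. *)
pose G := [set C : set natp | exists N : nat, F [set n | (N < val n)%N -> C n]].
have PG : ProperFilter G.
  split=> [[N FN]|].
    by have [n nN] := F_gt _ N FN; exact: nN.
  split.
  - by exists 0; apply: filterE.
  - move=> C D [N FC] [M FD]; exists (maxn N M).
    apply: filterS2 FC FD => n nC nD; rewrite /= gtn_max => /andP[Nn Mn].
    by split; [exact: nC|exact: nD].
  - move=> C D CD [N FC]; exists N.
    by apply: filterS FC => n nC /nC; exact: CD.
have [U [uU GU]] := ultraFilterLemma PG.
exists (BetaN uU); last first.
  by move=> C FC; apply: GU; exists 0; apply: filterS FC => n Cn _.
by apply/nonprincipalP => N; apply: GU; exists N; apply: filterE => n /=.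
Qed.

(** Any nonprincipal [u] containing [B] works: for [n] in [B], the [m] in [B] beyond [n] form a set
    of [u], and [m > n] makes the pair consist of distinct elements. *)
Lemma pair_sums_ultra (B : set natp) C : infinite_set B ->
  pair_sums B `<=` C ->
  exists2 u, nonprincipal u & ultra_sets (ultra_add u u) C.
Proof.
move=> /infinite_set_natp B_gt BC.
have [|u u_np Bu] := nonprincipal_extension (globally B) _.
  by move=> D N BD; have [b /BD ? ?] := B_gt N; exists b.
have uB : ultra_sets u B by exact: Bu.
exists u => //=; apply: filterS (uB) => n Bn /=.
have /nonprincipalP/(_ (val n)) u_gt := u_np.
apply: filterS2 uB u_gt => m Bm nm; apply: BC; apply/pair_sumsP.
by exists n, m; split=> //=; rewrite addnC.
Qed.

Lemma ultra_pair_sums u C : nonprincipal u ->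
  ultra_sets (ultra_add u u) C ->
  exists2 B, infinite_set B & pair_sums B `<=` C.
Proof.
move=> /nonprincipalP u_gt uuC.
(* Choosing every [b] in [D] keeps the next constraint set, cut down by [C - b], in [u]. *)
pose D := [set n : natp | ultra_sets u (translate C (val n))].
have uD : ultra_sets u D by [].
(* In a state (b, S), b is the last chosen element of B, and S is the set in u
   to which all later elements belong. *)
have [next nextP] : exists next : natp * set natp -> natp * set natp,
    forall x, ultra_sets u x.2 -> let y := next x in
    [/\ x.2 y.1, D y.1, (val x.1 < val y.1)%N &
        y.2 = x.2 `&` translate C (val y.1)].
  suff /boolp.choice[f fP] : forall x : natp * set natp,
      exists y : natp * set natp, ultra_sets u x.2 ->
      [/\ x.2 y.1, D y.1, (val x.1 < val y.1)%N &
          y.2 = x.2 `&` translate C (val y.1)] by exists f.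
  (* If [S] is not in [u], nothing is required of the next state, so any value will do. *)
  move=> [b S]; have [uS|] := pselect (ultra_sets u S); last by exists (b, S).
  have [c [[Sc Dc] bc]] := filter_ex (filterI (filterI uS uD) (u_gt (val b))).
  by exists (c, S `&` translate C (val c)).
pose one : natp := exist _ 1 isT.
pose state k := iter k next (one, [set: natp]).
have u_state k : ultra_sets u (state k).2.
  elim: k => [|k IHk]; first exact: filterT.
  by have /= [_ Dk _ ->] := nextP _ IHk; exact: filterI.
have stateP k := nextP _ (u_state k).
(* The index starts at [k.+1] because the 1 in the initial state is only a placeholder. *)
pose b k := (state k.+1).1.
have b_mono : {homo b : i j / (i < j)%N >-> (val i < val j)%N}.
  apply: homo_ltn => [x y z|k]; first exact: ltn_trans.
  by case: (stateP k.+1).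
have state_sub i j : (i <= j)%N -> (state j).2 `<=` (state i).2.
  elim: j => [|j IHj]; first by rewrite leqn0 => /eqP ->.
  rewrite leq_eqVlt => /orP[/eqP -> //|/IHj].
  by apply: subset_trans; have /= [_ _ _ ->] := stateP j; exact: subIsetl.
exists (range b).
  apply/infinite_set_natp => N; exists (b N) => //.
  elim: N => [|N IHN]; first exact: valP.
  by apply: leq_ltn_trans IHN _; exact: b_mono.
move=> m /pair_sumsP[_ [_ [[i _ <-] [j _ <-] bij mE]]].
have ij : (i < j)%N.
  rewrite ltnNge; apply/negP; rewrite leq_eqVlt => /orP[/eqP ji|/b_mono].
    by move: bij; rewrite ji ltnn.
  by rewrite ltnNge (ltnW bij).
(* [b j] was picked from the set of state [j]; as [i < j], that set lies in the set of state [i.+1],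
   hence in [C - b i]. *)
have [Sj _ _ _] := stateP j; have [_ _ _ Si] := stateP i.
have Cij : translate C (val (b i)) (b j).
  by have := state_sub _ _ ij _ Sj; rewrite Si => -[].
suff <- : natp_add (b j) (val (b i)) = m by exact: Cij.
by apply: val_inj; rewrite /= mE addnC.
Qed.

(** * Limits of the shift along ultrafilters and the adherence semigroup *)

Lemma ptws_cvgP (I : Type) (V : topologicalType) (F : set_system (I -> V))
    (f : I -> V) : Filter F ->
  (F --> (f : {ptws I -> V})) <-> (forall i, (fun g => g i) @ F --> f i).
Proof.
move=> FF; have proj_surj i : range (fun g : I -> V => g i) = [set: V].
  by apply/seteqP; split=> // v _; exists (fun=> v).
split=> [/cvg_sup Ff i|Ff].
  move/cvg_image : (Ff i) => /(_ (proj_surj i)) Fi W /Fi[D FD DW].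
  suff: F ((fun g => g i) @^-1` W) by [].
  by apply: filterS FD => g Dg; rewrite /= -DW; exists g.
apply/cvg_sup => i; apply/cvg_image => // W /Ff FW.
by exists ((fun g => g i) @^-1` W) => //; rewrite image_preimage.
Qed.

Lemma indicatorE A (n : natp) : indicator A (Posz (val n)) = true <-> A n.
Proof.
split=> [/asboolP[m Am [/val_inj->]] //|An].
by apply/asboolP; exists n.
Qed.

Lemma iter_shiftE k z j : iter k shift z j = z (j + Posz k)%R.
Proof. exact: (shiftzE (Posz k)). Qed.

Lemma iter_system_shiftE A k (z : system A) :
  val (iter k (@system_shift A) z) = iter k shift (val z).
Proof. by elim: k => //= k ->. Qed.

(** This is the limit of [T^n z] along [u]: a Boolean sequence converges along an ultrafilter to the
    value it takes on one of its members. *)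
Definition ultra_lim (u : betaN) (z : Sigma) : Sigma :=
  fun j => `[< ultra_sets u [set n : natp | z (j + Posz (val n))%R] >].

Lemma cvg_ultra_lim u z :
  iter (val n) shift z @[n --> ultra_sets u] --> ultra_lim u z.
Proof.
apply/ptws_cvgP => j W /nbhs_singleton Wz.
have uz :
      ultra_sets u [set n : natp | z (j + Posz (val n))%R = ultra_lim u z j].
  rewrite /ultra_lim; case: asboolP => // /ultra_setsC.
  by apply: filterS => n /= /negP/negbTE.
by apply: filterS uz => n /= zn; rewrite iter_shiftE zn.
Qed.

Lemma orbit_closure_iter A z k :
  orbit_closure A z -> orbit_closure A (iter k shift z).
Proof. by move=> Az; elim: k => //= k; exact: orbit_closure_shift. Qed.

Lemma orbit_closure_ultra_lim A u z :
  orbit_closure A z -> orbit_closure A (ultra_lim u z).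
Proof.
move=> Az; apply: (closed_cvg _ (@closed_closure _ _) _ _ (cvg_ultra_lim u z)).
by apply: filterE => n; exact: orbit_closure_iter.
Qed.

Definition system_ultra_lim A u (z : system A) : system A :=
  exist _ (ultra_lim u (val z))
    (mem_set (orbit_closure_ultra_lim _ u _ (set_mem (valP z)))).

Lemma cvg_system_ultra_lim A u (z : system A) :
  iter (val n) (@system_shift A) z @[n --> ultra_sets u] -->
  system_ultra_lim A u z.
Proof.
move=> W [_ [[V oV <-] Vz VW]].
have uV : ultra_sets u [set n : natp | V (iter (val n) shift (val z))].
  exact: (cvg_ultra_lim u (val z) V (open_nbhs_nbhs (conj oV Vz))).
suff: ultra_sets u [set n : natp | W (iter (val n) (@system_shift A) z)] by [].
by apply: filterS uV => n Vn; apply: VW; rewrite /= set_valE iter_system_shiftE.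
Qed.

Lemma adherence_ultra_lim A u : nonprincipal u ->
  adherence (@system_shift A) (system_ultra_lim A u).
Proof.
move=> /nonprincipalP u_gt m _ W Wu.
have cvgu : (iter (val n) (@system_shift A) : {ptws system A -> system A})
      @[n --> ultra_sets u] -->
      (system_ultra_lim A u : {ptws system A -> system A}).
  by apply/ptws_cvgP => z; exact: cvg_system_ultra_lim.
have uW : ultra_sets u [set n : natp | W (iter (val n) (@system_shift A))].
  exact: (cvgu W Wu).
have [n [Wn mn]] := filter_ex (filterI uW (u_gt m)).
exists (iter (val n) (@system_shift A)); split=> //.
by exists (val n) => //; exact: ltnW.
Qed.

(** The times [n] at which [T^n] enters a given neighbourhood of [e] are unbounded, so these sets of
    times extend to a nonprincipal [u]. The same [u] serves every [z], as the neighbourhoods are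
    taken in the space of all maps. *)
Lemma adherence_ultra A (e : system A -> system A) :
  adherence (@system_shift A) e ->
  exists2 u, nonprincipal u & forall z, val (e z) = ultra_lim u (val z).
Proof.
move=> eA.
pose tail (W : set {ptws system A -> system A}) :=
  [set n : natp | W (iter (val n) (@system_shift A))].
have FF : Filter (fun C => exists2 W, nbhs (e : {ptws system A -> system A}) W &
    tail W `<=` C).
  split=> [|C D [V eV VC] [W eW WD]|C D CD [W eW WC]].
  - by exists setT => //; exact: filterT.
  - exists (V `&` W); first exact: filterI.
    by move=> n [Vn Wn]; split; [exact: VC|exact: WD].
  - by exists W => //; exact: subset_trans CD.
have [C N [W eW WC]|u u_np Fu] := nonprincipal_extension _ FF.
  have [_ [[n /= Nn <-] Wn]] := eA N.+1 isT W eW.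
  by exists (exist _ n (leq_ltn_trans (leq0n N) Nn)) => //; exact: WC.
exists u => // z; apply/funext => j.
pose c : bool := val (e z) j.
(* Fixing coordinate [j] of the value at [z] is an open condition on maps: evaluation at [z], the
   inclusion into [Sigma] and the projection to [j] are continuous, and points of [bool] are
   open. *)
have uc : ultra_sets u [set n : natp | val z (j + Posz (val n))%R = c].
  apply: Fu; exists [set f | (val (f z) : Sigma) j = c].
    have zj : nbhs (val (e z) : Sigma) [set y | y j = c].
      exact: (@proj_continuous int (fun=> bool) j (val (e z)) _
        (discrete_set1 c)).
    have ezj : nbhs (e z) [set y : system A | (val y : Sigma) j = c].
      exact: (@initial_continuous _ _ set_val _ _ zj).
    exact: (@proj_continuous (system A) (fun=> system A) z _ _ ezj).
  by move=> n; rewrite /tail /= iter_system_shiftE iter_shiftE.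
rewrite -[LHS]/c /ultra_lim; case: asboolP => [uz|nuz].
  by have [n [<- zn]] := filter_ex (filterI uc uz); rewrite zn.
apply/negbTE/negP => c1; apply: nuz; apply: filterS uc => n /= ->; exact: c1.
Qed.

(** The outer and inner limits match the outer and inner variables of [u + u]. All indices
    [t + n + m] are positive, so the zero padding of the indicator never enters. *)
Lemma ultra_lim_double A u t :
  iter t shift (ultra_lim u (ultra_lim u (indicator A))) 0%R = true <->
  ultra_sets (ultra_add u u) (translate A t).
Proof.
rewrite iter_shiftE GRing.add0r.
have E : [set n : natp | ultra_lim u (indicator A) (Posz t + Posz (val n))%R] =
    [set n : natp | ultra_sets u (translate (translate A t) (val n))].
  apply/funext => n; apply/propext; rewrite /= translateD.
  suff -> : translate A (sval n + t) =
      [set m : natp | indicator A (Posz t + Posz (val n) + Posz (val m))%R].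
    by split=> [/asboolP|?] //; apply/asboolP.
  apply/funext => m; apply/propext.
  rewrite -[translate _ _ m]/(A (natp_add m (sval n + t))) -indicatorE /=.
  by rewrite -!PoszD addnC (addnC t).
by rewrite /= -E; split=> [/asboolP|?] //; apply/asboolP.
Qed.

Lemma adherence_square A (e : system A -> system A) u t :
  (forall z, val (e z) = ultra_lim u (val z)) ->
  (iter t (@system_shift A) @^-1` @system_cylinder A)
    ((e \o e) (system_base A)) <->
  ultra_sets (ultra_add u u) (translate A t).
Proof.
move=> eE; rewrite -ultra_lim_double /= /system_cylinder /=.
by rewrite iter_system_shiftE !eE.
Qed.

Theorem proposition4p3 (A : set natp) :
  [<->
    exists (B : set natp) (t : nat),
      infinite_set B /\ pair_sums B `<=` translate A t;
    exists (e : {ptws system A -> system A}) (t : nat),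
      adherence (@system_shift A) e /\
      (iter t (@system_shift A) @^-1` @system_cylinder A)
        ((e \o e) (system_base A));
    exists (u : betaN) (t : nat),
      nonprincipal u /\ ultra_sets (ultra_add u u) (translate A t);
    exists (u : betaN) (t : nat),
      nonprincipal u /\
      let p := u in
      let q := ultra_addn u t in
      [/\ nonprincipal p, nonprincipal q,
          ultra_add p q = ultra_add q p & ultra_sets (ultra_add p q) A];
    exists p q : betaN,
      [/\ nonprincipal p, nonprincipal q,
          ultra_add p q = ultra_add q p & ultra_sets (ultra_add p q) A] ].
Proof.
tfae.
- move=> [B [t [Binf /(pair_sums_ultra _ _ Binf)[u u_np uuA]]]].
  exists (system_ultra_lim A u), t; split; first exact: adherence_ultra_lim.
  exact/(adherence_square _ _ u).
- move=> [e [t [/adherence_ultra[u u_np eE] eeA]]].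
  by exists u, t; split=> //; exact/(adherence_square _ _ _ _ eE).
- move=> [u [t [u_np uuA]]]; exists u, t; split=> // p q; split=> //.
  + exact: nonprincipal_addn.
  + exact: ultra_addnC.
  (* With the shifted summand on the left, [t] can be moved onto [A]. *)
  + rewrite /p /q ultra_addnC; apply/ultra_addnE.
    by rewrite translate_ultra_set.
- by move=> [u [t [_ uP]]]; exists u, (ultra_addn u t).
- move=> [p [q [p_np q_np pqE pqA]]].
  have [u [t [upq uuA]]] := commuting_ultra_double _ _ _ pqE pqA.
  have u_np : nonprincipal u by case: upq => ->.
  by have [B ? ?] := ultra_pair_sums _ _ u_np uuA; exists B, t.
Qed.
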